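(* Let $M=(E,\Delta)$ be a matroid of rank $r$ that is realizable over some field, and let $f_1$ be the number of elements of $E$ that are not loops. Then there exists an integer $k_0\le (f_1r)^{3r}$ such that for every integer $k\ge k_0$ the $h$-vector $(h_0',\ldots,h_r')$ of the $k$-fold thickening $M^k$ is log-concave, i.e. $(h'_j)^2\ge h'_{j-1}h'_{j+1}$ for $j=1,\ldots,r-1$.
   Context: For a matroid $M=(E,\Delta)$ of rank $r$ (with $\Delta$ the set of independent sets) let $f_i$ be the number of independent sets of size $i$ and $f_M(q)=\sum_{i=0}^r f_iq^{r-i}$. The $h$-polynomial is $h_M(q)=f_M(q-1)=\sum_{i=0}^r h_iq^{r-i}$, and $(h_0,\ldots,h_r)$ is the $h$-vector; equivalently $h_j=\sum_{i=0}^j(-1)^{j-i}\binom{r-i}{j-i}f_i$. For a positive integer $k$, the $k$-fold thickening $M^k$ is the matroid on ground set $E\times\{1,\ldots,k\}$ whose independent sets are the $I\subseteq E\times\{1,\ldots,k\}$ such that $\pi_E(I)\in\Delta$ and $|\pi_E(I)|=|I|$, where $\pi_E$ is the projection to $E$ (if $M$ is realized by a list $X$, $M^k$ is realized by the list containing $k$ copies of each element of $X$). A loop is an element $e$ with $\{e\}\notin\Delta$. Realizable means representable by a list of vectors over some field. *)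

(* Defs.v *)
From HB Require Import structures.
From mathcomp Require Import all_boot all_order all_algebra.
Set Implicit Arguments. Unset Strict Implicit. Unset Printing Implicit Defensive.
Import Order.TTheory GRing.Theory Num.Theory.

Definition is_matroid (T : finType) (D : {set {set T}}) : Prop :=
  [/\ set0 \in D,
      (forall I J : {set T}, J \in D -> I \subset J -> I \in D) &
      (forall I J : {set T}, I \in D -> J \in D -> #|I| < #|J| ->
         exists2 x, x \in J :\: I & x |: I \in D)].

Definition realizable (T : finType) (D : {set {set T}}) : Prop :=
  exists (F : fieldType) (d : nat) (v : T -> 'rV[F]_d),
    forall I : {set T}, (I \in D) = free [seq v x | x <- enum I].

Definition mrank (T : finType) (D : {set {set T}}) : nat :=
  \max_(I in D) #|I|.

Definition nonloops (T : finType) (D : {set {set T}}) : nat :=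
  #|[set x : T | [set x] \in D]|.

Definition fvec (T : finType) (D : {set {set T}}) (i : nat) : nat :=
  #|[set I in D | #|I| == i]|.

Definition hvec (T : finType) (D : {set {set T}}) (j : nat) : int :=
  (\sum_(i < j.+1)
     (-1) ^+ (j - i)%N * ('C(mrank D - i, j - i))%:Z * (fvec D i)%:Z)%R.

Definition thickening (T : finType) (D : {set {set T}}) (k : nat)
  : {set {set (T * 'I_k)}} :=
  [set I : {set (T * 'I_k)} | ((@fst T 'I_k) @: I \in D)
                              && (#|(@fst T 'I_k) @: I| == #|I|)].

Definition h_logconcave (T : finType) (D : {set {set T}}) : Prop :=
  forall j : nat, (0 < j)%N -> (j < mrank D)%N ->
    (hvec D j.-1 * hvec D j.+1 <= hvec D j ^+ 2)%R.

(* Main.v *)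
Require Import Defs.
From HB Require Import structures.
From mathcomp Require Import all_boot all_order all_algebra.
From mathcomp Require Import ring lra zify.
Set Implicit Arguments. Unset Strict Implicit. Unset Printing Implicit Defensive.
Import Order.TTheory GRing.Theory Num.Theory.

(** The thickening has [f'_i = k ^ i * f_i], so [h'_j] is [k ^ j * f_j] up to a
    relative error of order [r ^ 2 / k], and it suffices that [f] is log-concave with
    a margin: Mason's inequality [(j + 1) f_(j-1) f_(j+1) <= j f_j ^ 2]. With [m = j + 1],
    it says that the Hessian [M] at [y = 0], [x = 1] of
    [\sum_(I in D) y^(m - |I|) / (m - |I|)! * \prod_(i in I) x_i] is hyperbolic:
    [<w, M v> = 0] implies [<v, M v> <= 0], for [w] the all-ones vector in the [x]
    directions. Hyperbolicity is proved for all contractions, by induction on the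
    degree. By Euler's formula [M] is a multiple of the sum of the Hessians of the
    contractions by single elements, whose hyperbolicity gives the Bochner inequality
    [<v, M v> <= \sum_i (M v)_i ^ 2 / (M w)_i]. This inequality, the connectedness of
    the graph of non-parallel elements and linear algebra for its Laplacian imply
    hyperbolicity of [M]. In degree 2 the matrix is that of a complete multipartite
    graph on the parallel classes with a cone vertex added. *)

(** * Linear algebra: graph Laplacians and hyperbolic forms *)

Section LinearAlgebra.
Local Open Scope ring_scope.

(** A square matrix with trivial kernel is invertible, phrased for functions on [T] so that no
    enumeration appears later. *)
Lemma injective_system_solvable (F : fieldType) (T : finType) (Q : T -> T -> F) :
  (forall x : T -> F, (forall i, \sum_j Q i j * x j = 0) -> forall i, x i = 0) ->
  forall y : T -> F, exists x : T -> F, forall i, \sum_j Q i j * x j = y i.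
Proof.
move=> Qinj y.
pose A : 'M[F]_#|T| := \matrix_(j, i) Q (enum_val i) (enum_val j).
have mulA (v : 'rV[F]_#|T|) i :
    (v *m A) 0 (enum_rank i) = \sum_j Q i j * v 0 (enum_rank j).
  rewrite mxE (reindex (@enum_rank T)) /=; last exact/onW_bij/enum_rank_bij.
  by apply: eq_bigr => j _; rewrite mxE !enum_rankK mulrC.
have Aunit : A \in unitmx.
  rewrite -row_free_unit; apply: inj_row_free => v vA0; apply/rowP => k.
  rewrite mxE -[k]enum_valK.
  by apply: (Qinj (fun j => v 0 (enum_rank j))) => i; rewrite -mulA vA0 mxE.
exists (fun j => ((\row_k y (enum_val k)) *m invmx A) 0 (enum_rank j)) => i.
by rewrite -mulA mulmxKV // mxE enum_rankK.
Qed.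

Section Hyperbolic.
Variables (F : realFieldType) (T : finType).
Variables (B : T -> T -> F) (b : T -> F) (c : F).
Hypothesis Bsym : forall i j, B i j = B j i.
Implicit Types (t : F) (x u p : T -> F).

Definition wdeg i := \sum_j B i j.

Definition bform x u := \sum_i x i * (\sum_j B i j * u j).

(* The symmetric matrix with blocks [c], [b], [B] acts on the vector [(t, x)];
   [grad] is the [T]-part of the image and [qform] the quadratic form. *)
Definition grad t x i := \sum_j B i j * x j + t * b i.

Definition qform t x := bform x x + 2 * t * (\sum_i b i * x i) + c * t ^+ 2.

Lemma bformC x u : bform x u = bform u x.
Proof.
rewrite /bform; under eq_bigr => i _ do rewrite mulr_sumr.
rewrite exchange_big /=; apply: eq_bigr => i _; rewrite mulr_sumr.
by apply: eq_bigr => j _; rewrite Bsym; ring.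
Qed.

Lemma sum_grad t x : \sum_i grad t x i = \sum_i wdeg i * x i + t * \sum_i b i.
Proof.
rewrite big_split /= -mulr_sumr; congr (_ + _).
have -> : \sum_i \sum_j B i j * x j = bform (fun=> 1) x.
  by apply: eq_bigr => i _; rewrite mul1r.
rewrite bformC; apply: eq_bigr => i _; rewrite mulrC; congr (_ * _).
by apply: eq_bigr => j _; rewrite mulr1.
Qed.

Lemma qform_sub t u p :
  qform t (fun i => u i - p i) =
  qform t u - 2 * (\sum_i p i * grad t u i) + bform p p.
Proof.
have subr x : bform x (fun i => u i - p i) = bform x u - bform x p.
  rewrite /bform -sumrB; apply: eq_bigr => i _; rewrite -mulrBr -sumrB.
  by congr (_ * _); apply: eq_bigr => j _; ring.
rewrite /qform subr (bformC _ u) (bformC _ p) !subr.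
have -> : \sum_i b i * (u i - p i) = \sum_i b i * u i - \sum_i b i * p i.
  by rewrite -sumrB; apply: eq_bigr => i _; rewrite mulrBr.
have -> : \sum_i p i * grad t u i = bform p u + t * \sum_i b i * p i.
  rewrite /bform mulr_sumr -big_split /=; apply: eq_bigr => i _.
  by rewrite /grad; ring.
rewrite [bform u p]bformC; ring.
Qed.

(** The diagonal matrix of [wdeg] minus [B] is the Laplacian of the graph with edge weights [B]. For
    nonnegative weights the right side makes it positive semidefinite, with kernel the functions
    constant along edges. *)
Lemma laplacianE x :
  2 * (\sum_i wdeg i * x i ^+ 2 - bform x x) =
  \sum_i \sum_j B i j * (x i - x j) ^+ 2.
Proof.
have -> : \sum_i \sum_j B i j * (x i - x j) ^+ 2 =
    \sum_i \sum_j (B i j * x i ^+ 2 + B i j * x j ^+ 2) - 2 * bform x x.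
  rewrite /bform mulr_sumr -sumrB; apply: eq_bigr => i _.
  rewrite !mulr_sumr -sumrB; apply: eq_bigr => j _; ring.
under [X in _ = X - _]eq_bigr => i _ do rewrite big_split /=.
rewrite big_split /= [X in _ = _ + X - _]exchange_big /=.
have <- : \sum_i wdeg i * x i ^+ 2 = \sum_i \sum_j B i j * x i ^+ 2.
  by apply: eq_bigr => i _; rewrite mulr_suml.
have <- : \sum_i wdeg i * x i ^+ 2 = \sum_j \sum_i B i j * x j ^+ 2.
  apply: eq_bigr => i _; rewrite mulr_suml.
  by apply: eq_bigr => j _; rewrite Bsym.
ring.
Qed.

Hypothesis Bge0 : forall i j, 0 <= B i j.

Lemma bform_le_wdeg x : bform x x <= \sum_i wdeg i * x i ^+ 2.
Proof.
have : 0 <= \sum_i \sum_j B i j * (x i - x j) ^+ 2.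
  by apply: sumr_ge0 => i _; apply: sumr_ge0 => j _; rewrite mulr_ge0 ?sqr_ge0.
by rewrite -laplacianE; lra.
Qed.

Lemma wdeg_eq0 i j : wdeg i = 0 -> B i j = 0.
Proof.
move=> /eqP; rewrite psumr_eq0 // => /allP /(_ j (mem_index_enum j)).
by move/eqP.
Qed.

Hypothesis b0 : forall i, wdeg i = 0 -> b i = 0.
(** Connectedness of the graph on the vertices of nonzero degree, in the form that describes the
    kernel of the Laplacian. *)
Hypothesis Bconn : forall x : T -> F,
  (forall i j, B i j != 0 -> x i = x j) ->
  forall i j, wdeg i != 0 -> wdeg j != 0 -> x i = x j.

Lemma grad_eq0 t x i : wdeg i = 0 -> grad t x i = 0.
Proof.
move=> wi; rewrite /grad b0 // mulr0 addr0 big1 // => j _.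
by rewrite wdeg_eq0 ?mul0r.
Qed.

Let e i : F := (wdeg i != 0)%:R.

(** The Laplacian made injective: the identity is added on isolated vertices, and the rank-one
    matrix [e i * e j] removes the constants on the others from the kernel. *)
Let shifted i j := (i == j)%:R * (wdeg i + (1 - e i)) - B i j + e i * e j.

Let shiftedE x i : \sum_j shifted i j * x j =
  (wdeg i + (1 - e i)) * x i - \sum_j B i j * x j + e i * \sum_j e j * x j.
Proof.
have -> : (wdeg i + (1 - e i)) * x i =
    \sum_j (i == j)%:R * (wdeg i + (1 - e i)) * x j.
  rewrite (bigD1 i) //= eqxx mul1r big1 ?addr0 // => j.
  by rewrite eq_sym => /negPf ->; rewrite !mul0r.
rewrite mulr_sumr -sumrB -big_split /=.
by apply: eq_bigr => j _; rewrite /shifted; ring.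
Qed.

Let e_idem i : e i * e i = e i.
Proof. by rewrite /e; case: eqP => _ /=; ring. Qed.

Let shifted_inj x : (forall i, \sum_j shifted i j * x j = 0) -> forall i, x i = 0.
Proof.
move=> Hx.
pose s := \sum_j e j * x j.
have e01 i : 0 <= 1 - e i by rewrite /e; case: eqP => _ /=; lra.
(* Pairing the system with [x] gives three nonnegative terms, so each vanishes: [x] is constant on
   the non-isolated vertices, zero on the isolated ones, and [s = 0] makes the constant zero. *)
have E : (\sum_i wdeg i * x i ^+ 2 - bform x x) +
     \sum_i (1 - e i) * x i ^+ 2 + s ^+ 2 = 0.
  transitivity (\sum_i x i * (\sum_j shifted i j * x j)); last first.
    by apply: big1 => i _; rewrite Hx mulr0.
  rewrite expr2 {1}/s mulr_suml /bform -sumrB -!big_split /=.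
  by apply: eq_bigr => i _; rewrite shiftedE -/s; ring.
have L := laplacianE x.
have P1 : 0 <= \sum_i \sum_j B i j * (x i - x j) ^+ 2.
  by apply: sumr_ge0 => i _; apply: sumr_ge0 => j _; rewrite mulr_ge0 ?sqr_ge0.
have P2 : 0 <= \sum_i (1 - e i) * x i ^+ 2.
  by apply: sumr_ge0 => i _; rewrite mulr_ge0 ?sqr_ge0.
have P3 := sqr_ge0 s.
have s0 : s = 0.
  by apply/eqP; rewrite -sqrf_eq0; apply/eqP; lra.
have Z2 : \sum_i (1 - e i) * x i ^+ 2 = 0 by lra.
have Z1 : \sum_i \sum_j B i j * (x i - x j) ^+ 2 = 0 by lra.
have xconst i j : B i j != 0 -> x i = x j.
  move=> Bij; move/eqP: Z1; rewrite psumr_eq0; last first.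
    by move=> k _; apply: sumr_ge0 => l _; rewrite mulr_ge0 ?sqr_ge0.
  move=> /allP /(_ i (mem_index_enum i)) /=; rewrite psumr_eq0; last first.
    by move=> l _; rewrite mulr_ge0 ?sqr_ge0.
  move=> /allP /(_ j (mem_index_enum j)) /=.
  by rewrite mulf_eq0 (negPf Bij) sqrf_eq0 subr_eq0 => /eqP.
move=> i; have [wi|wi] := eqVneq (wdeg i) 0.
  move/eqP: Z2; rewrite psumr_eq0; last by move=> k _; rewrite mulr_ge0 ?sqr_ge0.
  move=> /allP /(_ i (mem_index_enum i)) /=.
  by rewrite /e wi eqxx subr0 mul1r sqrf_eq0 => /eqP.
have : (\sum_j e j) * x i = 0.
  apply: etrans s0; rewrite mulr_suml; apply: eq_bigr => j _; rewrite /e.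
  have [_|wj] := eqVneq (wdeg j) 0; first by rewrite !mul0r.
  by rewrite (Bconn xconst wi wj).
move/eqP; rewrite mulf_eq0 => /orP [|/eqP //].
rewrite psumr_eq0; last by move=> j _; rewrite ler0n.
by move=> /allP /(_ i (mem_index_enum i)) /=; rewrite /e wi oner_eq0.
Qed.

(** Off the isolated vertices the equation says that the Laplacian of [u] is
    [wdeg i * x i + t * b i], whose sum is zero by hypothesis, so that it is orthogonal to the
    constants. *)
Let laplacian_solvable t x : \sum_i grad t x i = 0 ->
  exists u : T -> F, forall i, u i - grad t u i / wdeg i = x i.
Proof.
move=> G0.
have [u Hu] := injective_system_solvable shifted_inj
   (fun i => wdeg i * x i + t * b i + (1 - e i) * x i).
pose s := \sum_j e j * u j.
have e_wdeg i : e i * wdeg i = wdeg i.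
  by rewrite /e; case: eqP => [->|_] /=; ring.
have e_b i : e i * b i = b i.
  by rewrite /e; case: eqP => [/b0 ->|_] /=; ring.
(* Summing the shifted system against [e] cancels the Laplacian, so the rank-one correction vanishes
   and [u] solves the unshifted system. *)
have es : (\sum_i e i) * s = 0.
  have : \sum_i e i * (\sum_j shifted i j * u j) = \sum_i wdeg i * x i + t * \sum_i b i.
    rewrite mulr_sumr -big_split /=; apply: eq_bigr => i _; rewrite Hu.
    by rewrite -[in RHS]e_wdeg -[in RHS]e_b; have := e_idem i => ei; ring: ei.
  rewrite -sum_grad G0; apply: etrans.
  have -> : (\sum_i e i) * s = (\sum_i wdeg i * u i - \sum_i wdeg i * u i) +
     (\sum_i e i) * s by ring.
  have {2}-> : \sum_i wdeg i * u i = \sum_i \sum_j B i j * u j.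
    have := sum_grad 0 u; rewrite mul0r addr0 => <-.
    by apply: eq_bigr => i _; rewrite /grad mul0r addr0.
  rewrite mulr_suml -sumrB -big_split /=; apply: eq_bigr => i _.
  rewrite shiftedE -/s.
  have [wi|wi] := eqVneq (wdeg i) 0.
    rewrite /e wi eqxx /= !mul0r addr0 big1 ?subr0 // => j _.
    by rewrite wdeg_eq0 // mul0r.
  by rewrite /e wi /=; ring.
have es0 i : e i * s = 0.
  move/eqP: es; rewrite mulf_eq0 => /orP [|/eqP ->]; last by rewrite mulr0.
  rewrite psumr_eq0; last by move=> j _; rewrite ler0n.
  by move=> /allP /(_ i (mem_index_enum i)) /= /eqP ->; rewrite mul0r.
exists u => i; have := Hu i; rewrite shiftedE -/s es0 addr0.
have [wi|wi] := eqVneq (wdeg i) 0.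
  rewrite grad_eq0 // mul0r subr0 b0 // /e wi eqxx /=.
  rewrite big1; last by move=> j _; rewrite wdeg_eq0 // mul0r.
  by move=> H; lra.
rewrite /grad /e wi /= => H.
apply: (mulfI wi); rewrite mulrBr mulrCA divff // mulr1.
by lra.
Qed.

(* Writing [(t, x) = u - P u] with [P u = (0, grad u / wdeg)], the form becomes
   [q u - 2 |P u|^2 + q (P u)] where [|p|^2 = \sum_i wdeg i * p i ^+ 2]; both [q u]
   and [q (P u)] are at most [|P u|^2]. *)
Lemma qform_le0_of_bochner :
  (forall t x, qform t x <= \sum_i grad t x i ^+ 2 / wdeg i) ->
  forall t x, \sum_i grad t x i = 0 -> qform t x <= 0.
Proof.
move=> bochner t x /laplacian_solvable [u Hu].
pose p i := grad t u i / wdeg i.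
have -> : qform t x = qform t (fun i => u i - p i).
  have xE i : x i = u i - p i by rewrite Hu.
  rewrite /qform /bform; under eq_bigr => i _.
    rewrite xE; under eq_bigr => j _ do rewrite xE; over.
  by under [X in _ + _ * X + _]eq_bigr => i _ do rewrite xE.
rewrite qform_sub.
have := bform_le_wdeg p; have := bochner t u.
have -> : \sum_i grad t u i ^+ 2 / wdeg i = \sum_i p i * grad t u i.
  by apply: eq_bigr => i _; rewrite /p; ring.
have -> : \sum_i wdeg i * p i ^+ 2 = \sum_i p i * grad t u i.
  apply: eq_bigr => i _; rewrite /p.
  have [wi|wi] := eqVneq (wdeg i) 0; first by rewrite grad_eq0 // wi !mul0r.
  by field.
lra.
Qed.

End Hyperbolic.

(** Subtracting [G / W] times the all-ones vector makes the gradient sum to zero; hyperbolicity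
    applied to the difference is the claim. *)
Lemma reverse_cauchy_schwarz (F : realFieldType) (T : finType)
    (B : T -> T -> F) (b : T -> F) (c : F) :
  (forall i j, B i j = B j i) ->
  (forall t x, \sum_i grad B b t x i = 0 -> qform B b c t x <= 0) ->
  0 < \sum_i wdeg B i ->
  forall t x, qform B b c t x * (\sum_i wdeg B i) <= (\sum_i grad B b t x i) ^+ 2.
Proof.
move=> Bsym hyp W0 t x.
set W := \sum_i wdeg B i in W0 *; set G := \sum_i grad B b t x i.
have := hyp t (fun i => x i - G / W).
rewrite sum_grad // -/W.
have -> : \sum_i wdeg B i * (x i - G / W) + t * \sum_i b i = G - W * (G / W).
  rewrite /G sum_grad // [in RHS]mulr_suml addrAC -sumrB; congr (_ + _).
  by apply: eq_bigr => i _; rewrite mulrBr.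
rewrite mulrCA divff ?gt_eqF // mulr1 subrr => /(_ erefl).
rewrite qform_sub //.
have -> : \sum_i G / W * grad B b t x i = G ^+ 2 / W by rewrite -mulr_sumr -/G; ring.
have -> : bform B (fun=> G / W) (fun=> G / W) = G ^+ 2 / W.
  rewrite /bform; under eq_bigr => i _ do rewrite -mulr_suml -/(wdeg B i).
  by rewrite -mulr_sumr -mulr_suml -/W; field; rewrite gt_eqF.
move=> H; rewrite -ler_pdivlMr //; lra.
Qed.

End LinearAlgebra.

(** * Counting independent sets in contractions *)

Section Counting.
Variables (T : finType) (D : {set {set T}}).
Implicit Types (S X I J : {set T}) (a i j : T) (k m : nat).

Definition nsup k X := #|[set I in D | (X \subset I) && (#|I| == k)]|.

(* The effect on [G] of contracting the element [a]: a partial derivative. *)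
Definition der (G : {set T} -> nat) S a := if a \in S then 0 else G (a |: S).

Definition link1 k S a := der (nsup k) S a.
Definition link2 k S a i := der (fun X => link1 k X a) S i.

Lemma link2E k S a i :
  link2 k S a i = if [|| i \in S, a \in S | a == i] then 0 else nsup k (a |: (i |: S)).
Proof.
by rewrite /link2 /link1 /der !inE; do 3!case: ifP => //=; rewrite orbC => -> .
Qed.

Lemma link2C k S a i : link2 k S a i = link2 k S i a.
Proof. by rewrite !link2E setUCA orbCA eq_sym. Qed.

(** Euler's formula, by double counting the pairs [(I, a)] with [a] in [I :\: S]. *)
Lemma sum_link1 k S : \sum_a link1 k S a = (k - #|S|) * nsup k S.
Proof.
transitivity (\sum_a \sum_(I in [set I in D | (S \subset I) && (#|I| == k)])
                (a \in I :\: S)).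
  apply: eq_bigr => a _; rewrite /link1 /der.
  case: ifP => aS; first by rewrite big1 // => I _; rewrite inE aS.
  rewrite /nsup -sum1_card big_mkcond [RHS]big_mkcond /=; apply: eq_bigr => I _.
  rewrite !inE aS /= subUset sub1set; by case: (I \in D); case: (a \in I); case: (S \subset I); case: (#|I| == k).
rewrite exchange_big /= mulnC -sum_nat_const.
apply: eq_bigr => I; rewrite inE => /and3P [_ SI /eqP <-].
by rewrite -cardsDS // -sum1_card [RHS]big_mkcond.
Qed.

Lemma sum_link2 k S a : \sum_i link2 k S a i = (k - #|S|.+1) * link1 k S a.
Proof.
under eq_bigr => i _ do rewrite link2C.
rewrite /link2 {2}/link1 /der; case: ifP => aS; first by rewrite big1 ?muln0.
by rewrite sum_link1 cardsU1 aS.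
Qed.

Lemma sum_der_link1 k S a :
  \sum_i der (fun X => link1 k X a) S i = (k - #|S|.+1) * link1 k S a.
Proof. exact: sum_link2. Qed.

(** Derivatives commute: those in [a] and [j] are swapped so that [sum_link2] applies to
    [j |: S]. *)
Lemma sum_der_link2 k S i j :
  \sum_a der (fun X => link2 k X i j) S a = (k - #|S|.+2) * link2 k S i j.
Proof.
transitivity (\sum_a der (fun X => link2 k X i a) S j).
  apply: eq_bigr => a _; rewrite /link2 /der !inE setUCA (eq_sym a j).
  by case: (a \in S); case: (j \in S); case: (j == a).
rewrite /der {2}/link2 /der; case: ifP => jS; first by rewrite big1 ?muln0.
by rewrite sum_link2 cardsU1 jS.
Qed.

Hypothesis matD : is_matroid D.

Lemma nsup_gt0_indep k X : 0 < nsup k X -> X \in D.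
Proof.
case: matD => _ sub _; rewrite card_gt0 => /set0Pn [I].
by rewrite inE => /and3P [ID XI _]; apply: sub XI.
Qed.

Lemma indep_extend k X : X \in D -> #|X| <= k <= mrank D ->
  exists2 I, I \in D & (X \subset I) && (#|I| == k).
Proof.
case: matD => D0 sub exch XD.
elim: k => [|k IH] /andP [Xk kr].
  by exists X; rewrite // subxx -leqn0.
move: Xk; rewrite leq_eqVlt => /orP [/eqP Xk|Xk].
  by exists X; rewrite // subxx Xk eqxx.
have [|I ID /andP [XI /eqP Ik]] := IH; first by apply/andP; split => //; apply: ltnW.
have [J JD Jr] : {J | J \in D & #|J| = mrank D}.
  have cD : 0 < #|D| by apply/card_gt0P; exists set0.
  have [J JD JE] := eq_bigmax_cond (fun J : {set T} => #|J|) cD.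
  by exists J; rewrite // /mrank JE.
case: (exch I J) => //; first by rewrite Ik Jr.
move=> x; rewrite inE => /andP [xI _] xID; exists (x |: I) => //.
by rewrite (subset_trans XI) ?subsetU1 //= cardsU1 xI Ik.
Qed.

Lemma nsup_gt0 k X : #|X| <= k <= mrank D -> (0 < nsup k X) = (X \in D).
Proof.
move=> Xk; apply/idP/idP; first exact: nsup_gt0_indep.
move=> /indep_extend /(_ Xk) [I ID IX].
by rewrite card_gt0; apply/set0Pn; exists I; rewrite inE ID.
Qed.

(** Augmenting [a |: S] from [i |: (j |: S)]: in the contraction by [S], a non-loop is not parallel
    to both of two non-parallel elements. This gives transitivity of parallelism and connectedness
    of the non-parallel graph. *)
Lemma exchange2 S i j a : i |: (j |: S) \in D -> a |: S \in D ->
  i \notin S -> j \notin S -> i != j ->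
  [|| a \in S, i |: (a |: S) \in D | j |: (a |: S) \in D].
Proof.
case: matD => D0 sub exch ijD aD iS jS ij.
have [//|aS] /= := boolP (a \in S).
case: (exch (a |: S) (i |: (j |: S))) => //.
  by rewrite !cardsU1 aS !inE (negPf iS) (negPf jS) (negPf ij).
move=> x; rewrite !inE negb_or => /andP[/andP[_ xS] /or3P [/eqP-> ->|/eqP-> ->|]] //.
  by rewrite orbT.
by rewrite (negPf xS).
Qed.

End Counting.

(** * Operations on forms and the complete multipartite case *)

Section QformAlgebra.
Local Open Scope ring_scope.
Variables (F : realFieldType) (T : finType).
Implicit Types (B : T -> T -> F) (b : T -> F) (c t : F) (x : T -> F).

Lemma eq_qform B B' b b' c c' t x :
  B =2 B' -> b =1 b' -> c = c' -> qform B b c t x = qform B' b' c' t x.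
Proof.
move=> BB bb ->; rewrite /qform /bform; congr (_ + 2 * t * _ + _).
  apply: eq_bigr => i _; congr (_ * _).
  by apply: eq_bigr => j _; rewrite BB.
by apply: eq_bigr => i _; rewrite bb.
Qed.

Lemma qform_scale s B b c t x :
  qform (fun i j => s * B i j) (fun i => s * b i) (s * c) t x = s * qform B b c t x.
Proof.
rewrite /qform /bform !mulrDr; congr (_ + _ + _); last by ring.
  rewrite mulr_sumr; apply: eq_bigr => i _.
  by rewrite mulrCA !mulr_sumr; apply: eq_bigr => j _; ring.
by rewrite !mulr_sumr; apply: eq_bigr => i _; ring.
Qed.

Lemma qform_sum (I : finType) (B : I -> T -> T -> F) (b : I -> T -> F) (c : I -> F) t x :
  \sum_a qform (B a) (b a) (c a) t x =
  qform (fun i j => \sum_a B a i j) (fun i => \sum_a b a i) (\sum_a c a) t x.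
Proof.
rewrite /qform /bform !big_split /= mulr_suml; congr (_ + _ + _).
  rewrite exchange_big /=; apply: eq_bigr => i _; rewrite -mulr_sumr.
  congr (_ * _); rewrite exchange_big /=; apply: eq_bigr => j _.
  by rewrite mulr_suml.
rewrite -mulr_sumr exchange_big /=; congr (_ * _).
by apply: eq_bigr => i _; rewrite mulr_suml.
Qed.

(* [s] is the common part of the gradient, [y i] the weight of the class of [i] and
   [cl i] the size of that class: the form is [s^2 - \sum_i y i ^+ 2 / cl i]. *)
Lemma multipartite_hyperbolic (e : pred T) (par : rel T) (i0 : T) :
  e i0 -> symmetric par -> transitive par ->
  (forall i j, par i j -> e i) -> (forall i, e i -> par i i) ->
  forall t x,
    let B i j := (e i && e j)%:R - (par i j)%:R : F in
    let b i := (e i)%:R : F in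
    \sum_i grad B b t x i = 0 -> qform B b 1 t x <= 0.
Proof.
move=> ei0 psym ptrans par_e par_refl t x B b.
pose s := t + \sum_i b i * x i.
pose p i j : F := (par i j)%:R.
pose y i := \sum_j p i j * x j.
pose cl i := \sum_j p i j.
pose n := \sum_i b i.
have bb i : b i * b i = b i by rewrite /b; case: (e i); rewrite ?mul0r ?mul1r.
have Bx i : \sum_j B i j * x j = b i * (\sum_j b j * x j) - y i.
  rewrite mulr_sumr -sumrB; apply: eq_bigr => j _.
  by rewrite /B /b /p -mulnb natrM; ring.
have gradE i : grad B b t x i = b i * s - y i by rewrite /grad Bx /s; ring.
have qE : qform B b 1 t x = s ^+ 2 - \sum_i x i * y i.
  have -> : \sum_i x i * y i = (\sum_i b i * x i) ^+ 2 - bform B x x.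
    rewrite expr2 mulr_suml -sumrB; apply: eq_bigr => i _.
    by rewrite Bx; ring.
  by rewrite /qform /s; ring.
have pb i j : p i j * b i = p i j.
  by rewrite /p /b; case: (boolP (par i j)) => [/par_e ->|_]; rewrite ?mul0r ?mul1r.
have pC i j : p i j = p j i by rewrite /p psym.
have p_eq i j k : par i j -> p i k = p j k.
  move=> ij; rewrite /p; congr (_%:R); congr nat_of_bool; apply/idP/idP => H.
    by apply: ptrans H; rewrite psym.
  exact: ptrans H.
have y_eq i j : p i j * y i = p i j * y j.
  rewrite /p; case: (boolP (par i j)) => [ij|_]; last by rewrite !mul0r.
  by rewrite !mul1r; apply: eq_bigr => k _; rewrite (p_eq _ _ _ ij).
have cl_eq i j : p i j * y j / cl i = p i j * y j / cl j.
  rewrite /p; case: (boolP (par i j)) => [ij|_]; last by rewrite !mul0r.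
  by congr (_ / _); apply: eq_bigr => k _; rewrite (p_eq _ _ _ ij).
have p0 i j : 0 <= p i j by exact: ler0n.
have cl_gt0 i : e i -> 0 < cl i.
  move=> ei; rewrite /cl (bigD1 i) //= {1}/p par_refl //.
  by rewrite ltr_wpDr ?ltr01 // sumr_ge0.
have y_b i : b i * y i = y i.
  by rewrite mulr_sumr; apply: eq_bigr => j _; rewrite mulrA [b i * _]mulrC pb.
have y0 i : ~~ e i -> y i = 0 by move=> ei; rewrite -y_b /b (negPf ei) mul0r.
have xyE : \sum_i x i * y i = \sum_i y i ^+ 2 / cl i.
  (* Each product [x j * y j] is spread evenly over the class of [j]. *)
  transitivity (\sum_i \sum_j x j * (p i j * y j / cl j)).
    rewrite exchange_big; apply: eq_bigr => j _; rewrite -mulr_sumr -!mulr_suml.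
    have -> : \sum_i p i j = cl j by apply: eq_bigr => i _; rewrite pC.
    have [ej|ej] := boolP (e j); last by rewrite y0 // !(mulr0, mul0r).
    by field; rewrite gt_eqF ?cl_gt0.
  apply: eq_bigr => i _; rewrite expr2 -mulrA mulr_suml; apply: eq_bigr => j _.
  by rewrite -cl_eq -y_eq; ring.
have n_gt0 : 0 < n.
  rewrite /n (bigD1 i0) //= {1}/b ei0 ltr_wpDr ?ltr01 //.
  by apply: sumr_ge0 => i _; exact: ler0n.
have cl_n i : cl i <= n.
  apply: ler_sum => j _; rewrite pC -pb mulrC; rewrite /p /b.
  by case: (par j i); rewrite ?mulr0 ?mulr1 ?ler0n.
have lower : (\sum_i y i ^+ 2) / n <= \sum_i x i * y i.
  rewrite xyE mulr_suml; apply: ler_sum => i _.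
  have [ei|/y0 ->] := boolP (e i); last by rewrite expr0n !mul0r.
  rewrite ler_wpM2l ?sqr_ge0 // lef_pV2 // qualifE /= ?cl_gt0 //.
rewrite qE; under eq_bigr => i _ do rewrite gradE.
rewrite sumrB -mulr_suml -/n => Hs.
(* The hypothesis makes [s] the mean of [y] over the [n] elements of [e]; nonnegativity of the
   variance bounds [n * s ^+ 2] by the sum of the [y i ^+ 2]. *)
have : 0 <= \sum_i b i * (y i - s) ^+ 2.
  by apply: sumr_ge0 => i _; rewrite mulr_ge0 ?sqr_ge0 ?ler0n.
have -> : \sum_i b i * (y i - s) ^+ 2 = \sum_i y i ^+ 2 - 2 * s * (\sum_i y i) + n * s ^+ 2.
  rewrite /n mulr_sumr mulr_suml -sumrB -big_split /=; apply: eq_bigr => i _.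
  by rewrite -[in RHS]y_b; have bi := bb i; ring: bi.
have -> : \sum_i y i = n * s by lra.
move=> H; rewrite subr_le0; apply: le_trans lower.
by rewrite ler_pdivlMr //; lra.
Qed.

End QformAlgebra.

(** * Hyperbolicity of the Hessians and Mason's inequality *)

Section Mason.
Variables (T : finType) (D : {set {set T}}) (m : nat).
Hypotheses (matD : is_matroid D) (m_rank : m <= mrank D).
Local Open Scope ring_scope.
Implicit Types (S : {set T}) (a i j : T) (t : rat) (x : T -> rat).

(* Blocks of the Hessian at [y = 0], [x = 1] of the contraction by [S] of
   [\sum_(I in D) y^(m - |I|) / (m - |I|)! * \prod_(i in I) x_i],
   the block [c] belonging to the variable [y]. *)
Definition hessB S i j : rat := (link2 D m S i j)%:R.
Definition hessb S i : rat := (link1 D m.-1 S i)%:R.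
Definition hessc S : rat := (nsup D m.-2 S)%:R.

Definition hyperbolic S := forall t x,
  \sum_i grad (hessB S) (hessb S) t x i = 0 ->
  qform (hessB S) (hessb S) (hessc S) t x <= 0.

Lemma hessBC S i j : hessB S i j = hessB S j i.
Proof. by rewrite /hessB link2C. Qed.

Lemma hessB_ge0 S i j : 0 <= hessB S i j.
Proof. exact: ler0n. Qed.

Lemma wdeg_hessB S i : wdeg (hessB S) i = ((m - #|S|.+1) * link1 D m S i)%:R.
Proof. by rewrite -sum_link2 natr_sum. Qed.

Lemma nsup_card S : nsup D #|S| S = (S \in D).
Proof.
have [SD|SD] := boolP (S \in D); last first.
  by apply/eqP; rewrite -leqn0 leqNgt; apply: contra SD; apply: nsup_gt0_indep.
rewrite /nsup (_ : [set _ in _ | _] = [set S]) ?cards1 //.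
apply/setP => I; rewrite !inE; apply/and3P/eqP => [[_ SI /eqP IS]|->].
  by apply/eqP; rewrite eq_sym eqEcard SI IS /=.
by rewrite subxx eqxx.
Qed.

Lemma link1_gt0 S i : (#|S| < m)%N ->
  (0 < link1 D m S i)%N = (i \notin S) && (i |: S \in D).
Proof.
move=> Sm; rewrite /link1 /der; case: ifP => //= iS.
by rewrite nsup_gt0 // cardsU1 iS Sm.
Qed.

Lemma hessB_neq0 S i j : (#|S|.+1 < m)%N ->
  (hessB S i j != 0) = [&& i \notin S, j \notin S, i != j & i |: (j |: S) \in D].
Proof.
move=> Sm; rewrite /hessB pnatr_eq0 -lt0n link2E.
case: (boolP (j \in S)) => jS /=; first by rewrite andbF.
case: (boolP (i \in S)) => iS //=.
have [//|ij] /= := eqVneq i j.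
by rewrite nsup_gt0 // !cardsU1 !inE (negPf ij) (negPf iS) jS /= Sm.
Qed.

Lemma hyperbolic_base S : #|S|.+2 = m -> S \in D -> hyperbolic S.
Proof.
move=> Sm SD t x.
have sub (I J : {set T}) : J \in D -> I \subset J -> I \in D by case: matD => _ sub _; apply: sub.
pose e := [pred i | (i \notin S) && (i |: S \in D)].
(* Parallelism of non-loops in the contraction by [S]; its classes are the parts of the multipartite
   graph. *)
pose par : rel T := [rel i j | [&& e i, e j & (i == j) || (i |: (j |: S) \notin D)]].
have esub i j : i |: (j |: S) \in D -> i |: S \in D.
  by move=> H; apply: sub H _; rewrite setUS // subsetUr.
have [i0 ei0] : exists i, e i.
  have [|I ID /andP [SI /eqP Im]] := @indep_extend _ _ matD m S SD.
    by rewrite m_rank -Sm; lia.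
  have /subsetPn [i iI iS] : ~~ (I \subset S).
    by apply/negP => /subset_leq_card; rewrite Im -Sm; lia.
  exists i; rewrite /= iS /=; apply: sub ID _.
  by rewrite subUset sub1set iI SI.
have psym : symmetric par.
  move=> i j; rewrite /par /= setUCA (eq_sym i j).
  by rewrite andbCA.
have ptrans : transitive par.
  move=> j i k /and3P [ei ej ij] /and3P [_ ek jk]; apply/and3P; split => //.
  have [//|ik] /= := eqVneq i k; apply/negP => ikD.
  have [ij'|nij] := eqVneq i j; first by move: jk; rewrite -ij' ikD (negPf ik).
  have [jk'|njk] := eqVneq j k; first by move: ij; rewrite jk' ikD (negPf ik).
  move: ij jk; rewrite (negPf nij) (negPf njk) /= => ijD jkD.
  move: ei ej ek => /andP [iS _] /andP [jS jD] /andP [kS _].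
  have := exchange2 matD ikD jD iS kS ik.
  by rewrite (negPf jS) (negPf ijD) setUCA (negPf jkD).
have par_e i j : par i j -> e i by case/and3P.
have par_refl i : e i -> par i i by move=> ei; apply/and3P; rewrite eqxx.
have hyp := multipartite_hyperbolic (F := rat) ei0 psym ptrans par_e par_refl (t := t) (x := x).
have BE i j : hessB S i j = (e i && e j)%:R - (par i j)%:R.
  have eS k : k \in S -> e k = false by move=> kS; rewrite /e /= kS.
  have -> : par i j = [&& e i, e j & (i == j) || (i |: (j |: S) \notin D)] by [].
  rewrite /hessB link2E -Sm.
  have [iS|iS] := boolP (i \in S); first by rewrite eS //= orbT subrr.
  have [jS|jS] := boolP (j \in S); first by rewrite (eS j) //= !andbF subrr.
  have [->|ij] := eqVneq i j; first by rewrite /= !andbT andbb subrr.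
  have -> : #|S|.+2 = #|i |: (j |: S)|.
    by rewrite !cardsU1 !inE (negPf ij) (negPf iS) jS.
  rewrite nsup_card.
  have [ijD|ijD] := boolP (i |: (j |: S) \in D); last by rewrite /= !andbT subrr.
  have -> : e i by rewrite /e /= iS (esub _ _ ijD).
  have -> : e j by rewrite /e /= jS (esub j i) // setUCA.
  by rewrite subr0.
have bE i : hessb S i = (e i)%:R.
  rewrite /hessb /link1 /der -Sm /=; case: ifP => //= iS.
  have -> : #|S|.+1 = #|i |: S| by rewrite cardsU1 iS.
  by rewrite nsup_card.
have cE : hessc S = 1 by rewrite /hessc -Sm /= nsup_card SD.
rewrite (eq_qform _ _ BE bE cE) => H; apply: hyp.
rewrite -[RHS]H; apply: eq_bigr => i _; rewrite /grad bE; congr (_ + _).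
by apply: eq_bigr => j _; rewrite BE.
Qed.

(** Euler's formula for the second derivatives, homogeneous of degree [d.+1]; the term of the
    variable [y] drops out at [y = 0]. *)
Lemma qform_contract d S t x : (#|S| + d.+3 = m)%N ->
  d.+1%:R * qform (hessB S) (hessb S) (hessc S) t x =
  \sum_a if a \in S then 0
         else qform (hessB (a |: S)) (hessb (a |: S)) (hessc (a |: S)) t x.
Proof.
move=> Sm; rewrite -qform_scale.
pose B' a i j : rat := (der (fun X => link2 D m X i j) S a)%:R.
pose b' a i : rat := (der (fun X => link1 D m.-1 X i) S a)%:R.
pose c' a : rat := (der (fun X => nsup D m.-2 X) S a)%:R.
transitivity (\sum_a qform (B' a) (b' a) (c' a) t x); last first.
  apply: eq_bigr => a _; rewrite /B' /b' /c' /der; case: ifP => // _.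
  rewrite /qform /bform big1; last first.
    by move=> i _; rewrite big1 ?mulr0 // => j _; rewrite mul0r.
  by rewrite [X in _ * X]big1 ?mulr0 ?mul0r ?addr0 // => i _; rewrite mul0r.
rewrite qform_sum; apply: eq_qform => [i j|i|].
- rewrite /B' -natr_sum sum_der_link2 natrM; congr (_%:R * _); lia.
- rewrite /b' -natr_sum sum_der_link1 natrM; congr (_%:R * _); lia.
- rewrite /c' -natr_sum sum_link1 natrM; congr (_%:R * _); lia.
Qed.

(** The left side pairs the all-ones vector with the Hessian of the contraction by [a]; by Euler's
    formula this is a multiple of row [a] of the Hessian at [S]. *)
Lemma grad_contract d S a t x : (#|S| + d.+3 = m)%N -> a \notin S ->
  \sum_i grad (hessB (a |: S)) (hessb (a |: S)) t x i =
  d.+1%:R * grad (hessB S) (hessb S) t x a.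
Proof.
move=> Sm aS; have Sa : #|a |: S| = #|S|.+1 by rewrite cardsU1 aS.
rewrite (sum_grad _ (@hessBC _)) /grad mulrDr mulr_sumr; congr (_ + _).
  apply: eq_bigr => i _; rewrite wdeg_hessB Sa mulrA; congr (_ * _).
  rewrite natrM /hessB link2C /link2 /der (negPf aS); congr (_%:R * _); lia.
rewrite mulrCA -natr_sum sum_link1 Sa natrM; congr (_ * (_%:R * _)); first lia.
by rewrite /hessb /link1 /der (negPf aS).
Qed.

Lemma sum_wdeg_contract d S a : (#|S| + d.+3 = m)%N -> a \notin S ->
  \sum_i wdeg (hessB (a |: S)) i = d.+1%:R * wdeg (hessB S) a.
Proof.
move=> Sm aS; have := grad_contract 0 (fun=> 1) Sm aS.
rewrite (sum_grad _ (@hessBC _)) /grad !mul0r !addr0 => H.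
rewrite (_ : wdeg (hessB S) a = \sum_j hessB S a j * 1); last first.
  by apply: eq_bigr => j _; rewrite mulr1.
by rewrite -H; apply: eq_bigr => j _; rewrite mulr1.
Qed.

Lemma hyperbolic_step d S : (#|S| + d.+3 = m)%N -> S \in D ->
  (forall a, a \notin S -> a |: S \in D -> hyperbolic (a |: S)) -> hyperbolic S.
Proof.
move=> Sm SD IH.
have wdeg_ge0 i : 0 <= wdeg (hessB S) i by rewrite wdeg_hessB ler0n.
have wdeg_neq0 i : (wdeg (hessB S) i != 0) = (i \notin S) && (i |: S \in D).
  rewrite wdeg_hessB pnatr_eq0 -lt0n muln_gt0 link1_gt0; last by lia.
  by rewrite (_ : (0 < m - _)%N = true) //; lia.
apply: (qform_le0_of_bochner (@hessBC S) (@hessB_ge0 S)).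
- move=> i wi; apply/eqP; move/eqP: wi; apply: contraLR.
  rewrite /hessb pnatr_eq0 -lt0n wdeg_neq0 /link1 /der; case: ifP => //= _.
  exact: nsup_gt0_indep.
- move=> x xB i j; rewrite !wdeg_neq0 => /andP [iS iD] /andP [jS jD].
  have [-> //|ij] := eqVneq i j.
  have Sm2 : (#|S|.+1 < m)%N by lia.
  have [ijD|ijD] := boolP (i |: (j |: S) \in D).
    by apply: xB; rewrite hessB_neq0 // iS jS ij.
  (* Parallel [i] and [j] have a common neighbour [k], found by extending [i |: S] to an independent
     set of size [m]. *)
  have [|I ID /andP [SI /eqP Im]] := @indep_extend _ _ matD m (i |: S) iD.
    by rewrite m_rank cardsU1 iS; lia.
  have /subsetPn [k kI kS] : ~~ (I \subset i |: S).
    by apply/negP => /subset_leq_card; rewrite Im cardsU1 iS; lia.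
  have ikD : i |: (k |: S) \in D.
    case: matD => _ sub _; apply: sub ID _; rewrite setUCA.
    by rewrite subUset sub1set kI.
  move: kS; rewrite !inE negb_or => /andP [ki kS].
  have := exchange2 matD ikD jD iS kS _; rewrite eq_sym ki => /(_ isT).
  rewrite (negPf jS) (negPf ijD) /= => kjD.
  have kj : k != j by apply: contraNneq ijD => <-.
  have -> : x i = x k by apply: xB; rewrite hessB_neq0 // iS kS ikD eq_sym ki.
  by apply: xB; rewrite hessB_neq0 // jS kS kj kjD.
(* Bochner's inequality, term by term: [qform_contract] splits the form over contractions, and each
   summand is bounded by reverse Cauchy-Schwarz. *)
move=> t x.
have d_gt0 : 0 < d.+1%:R :> rat by rewrite ltr0n.
rewrite -(ler_pM2l d_gt0) (qform_contract _ _ Sm) mulr_sumr.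
apply: ler_sum => a _.
have rhs_ge0 : 0 <= grad (hessB S) (hessb S) t x a ^+ 2 / wdeg (hessB S) a.
  by rewrite divr_ge0 ?sqr_ge0.
case: ifPn => aS; first by rewrite mulr_ge0 // ltW.
have [aD|aD] := boolP (a |: S \in D); last first.
  apply: le_trans (mulr_ge0 (ltW d_gt0) rhs_ge0).
  have nsup0 k (X : {set T}) : (a |: S) \subset X -> nsup D k X = 0%N.
    move=> aX; apply/eqP; rewrite -leqn0 leqNgt; apply: contra aD.
    move=> /(nsup_gt0_indep matD) XD.
    by case: matD => _ sub _; apply: sub XD aX.
  have link10 k i (X : {set T}) : (a |: S) \subset X -> link1 D k X i = 0%N.
    move=> aX; rewrite /link1 /der; case: ifP => // _.
    by rewrite nsup0 // (subset_trans aX) ?subsetUr.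
  rewrite le_eqVlt; apply/orP; left; apply/eqP.
  (* For dependent [a |: S] all blocks vanish; the shape [0 * 0] lets [qform_scale] apply with
     factor zero. *)
  have B0 i j : hessB (a |: S) i j = 0 * 0.
    rewrite /hessB /link2 /der; case: ifP => [_|_]; first by rewrite mul0r.
    by rewrite link10 ?mul0r // subsetUr.
  have b0 i : hessb (a |: S) i = 0 * 0 by rewrite /hessb link10 ?mul0r.
  have c0 : hessc (a |: S) = 0 * 0 by rewrite /hessc nsup0 ?mul0r.
  by rewrite (eq_qform _ _ B0 b0 c0) qform_scale mul0r.
have wa : 0 < wdeg (hessB S) a by rewrite lt_neqAle eq_sym wdeg_neq0 aS aD wdeg_ge0.
have W0 : 0 < \sum_i wdeg (hessB (a |: S)) i.
  by rewrite (sum_wdeg_contract Sm) // mulr_gt0.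
have := reverse_cauchy_schwarz (@hessBC _) (IH a aS aD) W0 t x.
rewrite (grad_contract _ _ Sm aS) (sum_wdeg_contract Sm aS) exprMn => H.
by rewrite mulrA ler_pdivlMr // -(ler_pM2l d_gt0); lra.
Qed.

Lemma hyperbolic_all d S : (#|S| + d.+2 = m)%N -> S \in D -> hyperbolic S.
Proof.
elim: d S => [|d IH] S Sm SD.
  by apply: hyperbolic_base; rewrite // -Sm addn2.
apply: (hyperbolic_step Sm SD) => a aS; apply: IH.
by rewrite cardsU1 aS; lia.
Qed.

End Mason.

(** Reverse Cauchy-Schwarz for [S = set0], [m = j.+1] at the vector [t = 1], [x = 0]: the form is
    [fvec D j.-1], the gradient sum [j * fvec D j], and the total degree
    [j * (j.+1 * fvec D j.+1)]. *)
Lemma fvec_mason (T : finType) (D : {set {set T}}) (j : nat) :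
  is_matroid D -> 0 < j -> j < mrank D ->
  j.+1 * (fvec D j.-1 * fvec D j.+1) <= j * fvec D j ^ 2.
Proof.
move=> matD j0 jr.
have D0 : set0 \in D by case: matD.
have fE k : fvec D k = nsup D k set0.
  by apply: eq_card => I; rewrite !inE sub0set.
have Sm : #|(set0 : {set T})| + j.-1.+2 = j.+1 by rewrite cards0; lia.
have hyp := hyperbolic_all matD jr Sm D0.
have WE : (\sum_i wdeg (hessB D j.+1 set0) i = (j * (j.+1 * fvec D j.+1))%:R)%R.
  rewrite (eq_bigr _ (fun i _ => wdeg_hessB _ _ _ i)) -natr_sum -big_distrr /=.
  by rewrite sum_link1 cards0 subn1 subn0 fE.
have W0 : (0 < \sum_i wdeg (hessB D j.+1 set0) i)%R.
  rewrite WE ltr0n !muln_gt0 j0 /= fE nsup_gt0 // cards0 //.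
have := reverse_cauchy_schwarz (@hessBC _ _ _ _) hyp W0 1%R (fun=> 0%R).
rewrite WE (sum_grad _ (@hessBC _ _ _ _)) mul1r.
rewrite big1; last by move=> i _; rewrite mulr0.
rewrite add0r -natr_sum sum_link1 cards0 subn0 -fE.
rewrite /qform /bform !big1; try by move=> i _; rewrite ?mulr0 ?mul0r.
rewrite mulr0 !add0r expr1n mulr1 /hessc /= -fE -natrM -natrX ler_nat.
rewrite expnMn -[j ^ 2]/(j * j) -mulnA => H.
rewrite -(leq_pmul2l j0); lia.
Qed.

(** Double counting of inclusions: each independent set of size [i.-1] extends to one of size [i],
    which has only [i] subsets of size [i.-1]. *)
Lemma leq_fvec_pred (T : finType) (D : {set {set T}}) (i : nat) :
  is_matroid D -> 0 < i <= mrank D -> fvec D i.-1 <= i * fvec D i.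
Proof.
move=> matD /andP [i0 ir].
rewrite /fvec -sum1_card.
apply: (@leq_trans (\sum_(J in [set J in D | #|J| == i.-1])
                    \sum_(I in [set I in D | #|I| == i]) (J \subset I))).
  apply: leq_sum => J; rewrite inE => /andP [JD /eqP Ji].
  have [|I ID /andP [JI Ii]] := @indep_extend _ _ matD i J JD; first by rewrite Ji ir leq_pred.
  by rewrite (bigD1 I) ?inE ?ID //= JI.
rewrite exchange_big /= mulnC -sum_nat_const; apply: leq_sum => I.
rewrite inE => /andP [ID /eqP Ii].
have Ci : 'C(#|I|, i.-1) = i by rewrite Ii -{1}(prednK i0) binSn prednK.
rewrite -[leqRHS]Ci -cards_draws -sum1_card.
rewrite big_mkcond [leqRHS]big_mkcond /=; apply: leq_sum => J _; rewrite !inE.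
by case: (J \in D); case: (#|J| == i.-1); case: (J \subset I).
Qed.

(** * The f-vector and rank of the thickening *)

Section Thickening.
Variables (T : finType) (D : {set {set T}}) (k : nat).
Hypothesis k_gt0 : 0 < k.
Implicit Types (I : {set (T * 'I_k)}) (J : {set T}).

Definition transversals J : {set {set (T * 'I_k)}} :=
  [set I : {set (T * 'I_k)} | (@fst T 'I_k @: I == J) && (#|J| == #|I|)].

Let k0 : 'I_k := Ordinal k_gt0.

Definition graph_on J (f : {ffun T -> 'I_k}) : {set (T * 'I_k)} :=
  [set (x, f x) | x in J].

Lemma fst_graph_on J f : @fst T 'I_k @: graph_on J f = J.
Proof. by rewrite -imset_comp -[RHS]imset_id; apply: eq_imset. Qed.

Lemma card_graph_on J f : #|graph_on J f| = #|J|.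
Proof. by rewrite card_imset // => x y []. Qed.

Lemma transversals_graph_on J :
  transversals J = [set graph_on J f | f in pffun_on k0 J predT].
Proof.
apply/setP => I; rewrite inE; apply/andP/imsetP => [[/eqP IJ /eqP JI]|[f _ ->]]; last first.
  by rewrite fst_graph_on card_graph_on !eqxx.
have fstI : {in I &, injective (@fst T 'I_k)}.
  by apply/imset_injP; rewrite IJ JI.
(* The default [k0] off [J] is what [pffun_on k0 J] prescribes; it makes the function determined by
   its graph over [J]. *)
pose f := [ffun x => if [pick i | (x, i) \in I] is Some i then i else k0].
have IfJ x i : (x, i) \in I -> f x = i.
  move=> xi; rewrite ffunE; case: pickP => [i' xi'|/(_ i)]; last by rewrite xi.
  by have [] := fstI _ _ xi xi' erefl.
exists f.
  apply/pffun_onP; split; last by move=> ? ?.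
  apply/subsetP => x; rewrite inE ffunE; case: pickP => [i xi _|_]; last by rewrite eqxx.
  by rewrite -IJ; apply/imsetP; exists (x, i).
apply/eqP; rewrite eqEcard card_graph_on JI leqnn andbT.
apply/subsetP => -[x i] xi; apply/imsetP; exists x; last by rewrite (IfJ _ _ xi).
by rewrite -IJ; apply/imsetP; exists (x, i).
Qed.

Lemma card_transversals J : #|transversals J| = k ^ #|J|.
Proof.
rewrite transversals_graph_on card_in_imset ?card_pffun_on ?card_ord //.
move=> f g /pffun_onP [/subsetP fJ _] /pffun_onP [/subsetP gJ _] fg.
apply/ffunP => x; have [xJ|xJ] := boolP (x \in J).
  have : (x, f x) \in graph_on J g by rewrite -fg; apply: imset_f.
  by case/imsetP => y _ [-> ->].
have := contra (fJ x) xJ; have := contra (gJ x) xJ.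
by rewrite !inE !negbK => /eqP -> /eqP ->.
Qed.

Lemma fvec_thickening i : fvec (thickening D k) i = k ^ i * fvec D i.
Proof.
rewrite /fvec mulnC -sum_nat_const -sum1_card.
rewrite (partition_big (fun I => @fst T 'I_k @: I) [in [set J in D | #|J| == i]]) /=; last first.
  by move=> I; rewrite !inE => /andP [/andP [-> /eqP ->] ->].
apply: eq_bigr => J; rewrite inE => /andP [JD /eqP Ji].
rewrite -Ji -card_transversals -[RHS]sum1_card; apply: eq_bigl => I; rewrite !inE.
rewrite andbC; case: eqP => //= ->.
by rewrite JD /= Ji; case: eqP => [<-|]; rewrite ?eqxx ?andbF.
Qed.

Lemma mrank_thickening : mrank (thickening D k) = mrank D.
Proof.
apply/eqP; rewrite eqn_leq; apply/andP; split; apply/bigmax_leqP.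
  move=> I; rewrite inE => /andP [ID /eqP <-].
  exact: leq_bigmax_cond.
move=> J JD.
have : 0 < #|transversals J| by rewrite card_transversals expn_gt0 k_gt0.
rewrite card_gt0 => /set0Pn [I]; rewrite inE => /andP [/eqP IJ /eqP JI].
by rewrite JI /mrank leq_bigmax_cond // inE IJ JD JI eqxx.
Qed.

End Thickening.

(** * Bounds on the h-vector of the thickening and log-concavity *)

Definition alt_sum (a : nat -> nat) (j : nat) : int :=
  (\sum_(i < j.+1) (-1) ^+ (j - i)%N * (a i)%:Z)%R.

Lemma alt_sumS a j : (alt_sum a j.+1 = (a j.+1)%:Z - alt_sum a j)%R.
Proof.
rewrite /alt_sum big_ord_recr /= subnn mul1r addrC; congr (_ + _)%R.
rewrite -sumrN; apply: eq_bigr => i _.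
by rewrite subSn ?exprS ?mulN1r ?mulNr // -ltnS.
Qed.

(** The Leibniz argument for alternating sums, by induction through [alt_sumS]. *)
Lemma alt_sum_bounds a j : (forall i, i < j -> a i <= a i.+1) ->
  (0 <= alt_sum a j <= (a j)%:Z)%R.
Proof.
elim: j => [|j IH] mono.
  by rewrite /alt_sum big_ord1 subnn mul1r /=; lia.
have /andP [lo hi] := IH (fun i ij => mono i (ltnW ij)).
by have := mono j (ltnSn j); rewrite alt_sumS; lia.
Qed.

Lemma leq_binS n i : 'C(n.+1, i.+1) <= n.+1 * 'C(n, i).
Proof. by rewrite mul_bin_diag leq_pmull. Qed.

(* The terms of the alternating sum defining the h-vector increase in absolute value. *)
Lemma hvec_thickening_bounds (T : finType) (D : {set {set T}}) (k j : nat) :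
  is_matroid D -> 0 < k -> mrank D ^ 2 <= k -> j <= mrank D ->
  (0 <= hvec (thickening D k) j <= (k ^ j * fvec D j)%N%:Z)%R /\
  ((0 < j)%N -> (k ^ j * fvec D j)%N%:Z - (mrank D * (k ^ j.-1 * fvec D j.-1))%N%:Z
              <= hvec (thickening D k) j)%R.
Proof.
move=> matD k0 kr jr; set r := mrank D in kr jr *.
pose a i := 'C(r - i, j - i) * (k ^ i * fvec D i).
have -> : hvec (thickening D k) j = alt_sum a j.
  rewrite /hvec mrank_thickening //; apply: eq_bigr => i _.
  by rewrite fvec_thickening // /a [in RHS]PoszM mulrA.
have aj : a j = k ^ j * fvec D j by rewrite /a subnn bin0 mul1n.
(* From [i] to [i.+1] the binomial and [fvec] each lose at most a factor [r], which the new factor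
   [k >= r ^ 2] compensates. *)
have mono i : i < j -> a i <= a i.+1.
  move=> ij; rewrite /a -!(subnSK ij) -(subnSK (leq_trans ij jr)).
  apply: leq_trans (leq_mul (leq_binS _ _) (leqnn _)) _.
  rewrite subnSK ?(leq_trans ij) // -mulnA mulnCA leq_mul2l; apply/orP; right.
  have := @leq_fvec_pred T D i.+1 matD; rewrite (leq_trans ij jr) => /(_ isT) /= H.
  rewrite expnS; apply: (@leq_trans (r * (k ^ i * (r * fvec D i.+1)))).
    apply: leq_mul (leq_subr _ _) _; rewrite leq_mul2l (leq_trans H) ?orbT //.
    by rewrite leq_mul2r (leq_trans ij jr) orbT.
  have := leq_mul kr (leqnn (k ^ i * fvec D i.+1)); rewrite -mulnn; lia.
split; first by rewrite -aj; apply: alt_sum_bounds.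
case: j jr @a aj mono => // j jr a aj mono _; rewrite alt_sumS aj lerD2l lerN2.
have /andP [_ /le_trans -> //] := @alt_sum_bounds a j (fun i ij => mono i (ltnW ij)).
by rewrite lez_nat /a subSnn bin1 leq_mul2r leq_subr orbT.
Qed.

(** Mason's inequality leaves a factor [j / (j + 1) <= 1 - 1 / r]. Replacing [g1] by the lower bound
    [g1 - r * g0] costs at most the factor [(1 - 1 / (2 r)) ^ 2 >= 1 - 1 / r], since
    [k >= 2 * r ^ 3] forces [2 * r ^ 2 * g0 <= g1]. *)
Lemma h_logconcave_thickening (T : finType) (D : {set {set T}}) (k : nat) :
  is_matroid D -> 0 < k -> 2 * mrank D ^ 3 <= k -> h_logconcave (thickening D k).
Proof.
move=> matD k0 kr j j0; rewrite mrank_thickening // => jr.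
have kr2 : mrank D ^ 2 <= k.
  apply: leq_trans kr; rewrite expnS mulnA leq_pmull //; lia.
have [/andP [lo1 hi1] _] := hvec_thickening_bounds matD k0 kr2 (leq_trans (leq_pred j) (ltnW jr)).
have [/andP [lo2 hi2] _] := hvec_thickening_bounds matD k0 kr2 jr.
have [_ /(_ j0) lo] := hvec_thickening_bounds matD k0 kr2 (ltnW jr).
have M := fvec_mason matD j0 jr.
have P := @leq_fvec_pred T D j matD; rewrite j0 (ltnW jr) in P; move: P => /(_ isT) P.
set r := mrank D in kr kr2 jr lo *.
set f0 := fvec D j.-1 in hi1 lo M P; set f1 := fvec D j in lo M P.
set f2 := fvec D j.+1 in hi2 M.
pose g0 := k ^ j.-1 * f0; pose g1 := k ^ j * f1; pose g2 := k ^ j.+1 * f2.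
have kS : k ^ j = k * k ^ j.-1 by rewrite -expnS prednK.
have G : 2 * r ^ 2 * g0 <= g1.
  rewrite -(leq_pmul2l (_ : 0 < r)); last by lia.
  rewrite /g0 /g1 kS.
  apply: (@leq_trans (k * (k ^ j.-1 * f0))).
    by have := leq_mul kr (leqnn (k ^ j.-1 * f0)); rewrite expnS; lia.
  have P' : f0 <= r * f1 by rewrite (leq_trans P) // leq_mul2r ltnW ?orbT.
  by have := leq_mul (leqnn (k * k ^ j.-1)) P'; lia.
have M' : r * (g0 * g2) <= r.-1 * g1 ^ 2.
  have M1 : j.+1 * (g0 * g2) <= j * g1 ^ 2.
    have -> : g1 ^ 2 = k ^ j.-1 * k ^ j.+1 * f1 ^ 2.
      by rewrite /g1 expnMn -expnM -expnD; congr (k ^ _ * _); lia.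
    have -> : j.+1 * (g0 * g2) = k ^ j.-1 * k ^ j.+1 * (j.+1 * (f0 * f2)).
      by rewrite /g0 /g2; ring.
    by rewrite [leqRHS]mulnCA leq_mul2l M orbT.
  rewrite -(leq_pmul2l j0) [leqRHS]mulnCA.
  apply: leq_trans (leq_mul (leqnn _) M1).
  rewrite mulnA [leqRHS]mulnA leq_mul2r; apply/orP; right.
  by case: (r) jr => // r1 jr1; rewrite mulnS [leqRHS]mulnS /=; lia.
have ub : (hvec (thickening D k) j.-1 * hvec (thickening D k) j.+1 <= (g0 * g2)%N%:Z)%R.
  by rewrite PoszM; apply: ler_pM.
apply: le_trans ub _.
have r0 : 0 < r by exact: leq_ltn_trans jr.
have lo0 : (0 <= g1%:Z - (r * g0)%N%:Z)%R.
  rewrite subr_ge0 lez_nat; apply: leq_trans G; rewrite leq_mul2r; apply/orP; right.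
  by rewrite mulnCA leq_pmulr //; lia.
apply: (@le_trans _ _ ((g1%:Z - (r * g0)%N%:Z) ^+ 2)%R); last first.
  by rewrite ler_pXn2r // nnegrE (le_trans lo0).
move: M' G r0; clearbody g0 g1 g2; clear -r => M' G r0.
rewrite -(ler_pM2l (_ : (0 < r%:Z)%R)) //.
have A : (r%:Z * (g0%:Z * g2%:Z) <= (r%:Z - 1) * g1%:Z ^+ 2)%R.
  by case: (r) r0 M' => // r' _ /=; rewrite -lez_nat !PoszM; lia.
have B : (2 * r%:Z ^+ 2 * g0%:Z <= g1%:Z)%R by lia.
(* The cross term of [r * (g1 - r * g0) ^ 2] is at most [g1 ^ 2], exactly the margin in [A]. *)
have C := ler_wpM2r (isT : (0 <= g1%:Z)%R) B.
rewrite !PoszM; apply: le_trans A _.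
have : (0 <= r%:Z * (r%:Z * g0%:Z) ^+ 2)%R by rewrite mulr_ge0 ?sqr_ge0.
lia.
Qed.

Theorem mainTheorem4 (T : finType) (D : {set {set T}}) :
  is_matroid D -> realizable D ->
  exists k0 : nat,
    (k0 <= (nonloops D * mrank D) ^ (3 * mrank D))%N /\
    forall k : nat, (0 < k)%N -> (k0 <= k)%N -> h_logconcave (thickening D k).
Proof.
move=> matD _; exists ((nonloops D * mrank D) ^ (3 * mrank D)); split => // k k0 kk.
(* In rank at most 1 there is no interior index [j]. *)
have [r1|r1] := leqP (mrank D) 1.
  by move=> j j0; rewrite mrank_thickening // => jr; lia.
apply: h_logconcave_thickening => //; apply: leq_trans kk.
have n0 : 0 < nonloops D.
  have [||I ID /andP [_ /cards1P [x Ix]]] := @indep_extend _ _ matD 1 set0.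
  - by case: matD.
  - by rewrite cards0 (ltnW r1).
  by apply/card_gt0P; exists x; rewrite inE -Ix.
(* With [r >= 2] and at least one non-loop, [2 r^3 <= r^6 <= r^(3r) <= (f_1 r)^(3r)]. *)
apply: (@leq_trans (mrank D ^ 6)).
  rewrite -[6]/(3 + 3) expnD leq_mul2r; apply/orP; right.
  by apply: (@leq_trans (2 ^ 3)) => //; rewrite leq_exp2r.
apply: (@leq_trans (mrank D ^ (3 * mrank D))).
  by rewrite leq_exp2l //; lia.
by rewrite leq_exp2r ?leq_pmull //; lia.
Qed.
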